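(* With the notation of the context, let $j\colon F=T_{M,p}\hookrightarrow X=T_M$ be the inclusion of a fibre of the projection $\pi\colon X\to M$, which in local co-ordinates corresponds to fixing the $z_i$. Then the restriction $$\Omega_F=j^*q_\infty^*(\Omega_\infty)=\tfrac12\sum_{p,q}\omega_{pq}\,d\theta_p\wedge d\theta_q$$ is the linear symplectic form on $T_{M,p}$ defined by $\omega$, and $\Theta_F=j^*q_\infty^*(\Theta_\infty)$ is a symplectic potential for it. Let $\tau$ be the $\tau$-function defined using the flipped potential $2i\Theta_I'$, that is, $d\log(\tau)=q_0^*(\Theta_0)+2i\Theta_I'+q_\infty^*(\Theta_\infty)-q_1^*(\Theta_1)$. Then $$d\log(\tau|_F)=j^*q_\infty^*(\Theta_\infty)-j^*q_1^*(\Theta_1),$$ so that $\log(\tau|_F)$ is the generating function for the symplectic map $q_1\circ j\colon F\to Z_1$ with respect to the symplectic potentials $\Theta_F$ and $\Theta_1$.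
   Context: Everything is holomorphic. A period structure on a complex manifold $M$ of dimension $n$ is an atlas of distinguished charts whose transition functions are linear maps in $GL_n(\mathbb{Z})$; co-ordinates $(z_1,\dots,z_n)$ of a distinguished chart are called integral linear. They induce local co-ordinates $(z_i,\theta_j)$ on the total space $\pi\colon X=T_M\to M$ by writing tangent vectors as $\sum_i\theta_i\,\partial/\partial z_i$. A Joyce structure on $M$ consists of a period structure, a holomorphic symplectic form $\omega=\frac12\sum_{p,q}\omega_{pq}\,dz_p\wedge dz_q$, with $(\omega_{pq})$ a constant matrix in integral linear co-ordinates, whose inverse matrix $(\eta_{pq})$ has entries in $2\pi i\,\mathbb{Z}$, and a non-linear connection $h\colon\pi^*(T_M)\to T_X$ on $\pi$ of the following form. Set $v_i=v(\partial/\partial z_i)=\partial/\partial\theta_i$ (the vertical lift) and $$h_i=h\left(\frac{\partial}{\partial z_i}\right)=\frac{\partial}{\partial z_i}+\sum_{p,q}\eta_{pq}\frac{\partial^2W}{\partial\theta_i\partial\theta_p}\frac{\partial}{\partial\theta_q},$$ where $W=W(z,\theta)$ is a locally-defined function with $W(z,0)=0=\frac{\partial W}{\partial\theta_i}(z,0)$, satisfying $$\frac{\partial^2W}{\partial\theta_i\partial z_j}-\frac{\partial^2W}{\partial\theta_j\partial z_i}=\sum_{p,q}\eta_{pq}\frac{\partial^2W}{\partial\theta_i\partial\theta_p}\frac{\partial^2W}{\partial\theta_j\partial\theta_q},$$ together with the symmetries: the functions $\frac{\partial^2W}{\partial\theta_i\partial\theta_j}$ are invariant under $\theta\mapsto\theta+2\pi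 i k$ for $k\in\mathbb{Z}^n$; $W(\lambda z,\theta)=\lambda^{-1}W(z,\theta)$ for $\lambda\in\mathbb{C}^*$; and $W(z,-\theta)=-W(z,\theta)$. The connections $h_\epsilon=h+\epsilon^{-1}v$, for $\epsilon\in\mathbb{C}^*\cup\{\infty\}$, are then flat. The Euler vector field on $X$ is $E=\sum_i z_i\,\partial/\partial z_i$ (in the co-ordinates $(z_i,\theta_j)$); the same formula defines a vector field on $M$, also denoted $E$. There are closed 2-forms on $X$: $$\Omega_+=\tfrac12\sum\omega_{pq}\,dz_p\wedge dz_q,\qquad 2i\,\Omega_I=-\sum\omega_{pq}\,dz_p\wedge d\theta_q,$$ $$\Omega_-=\tfrac12\sum\omega_{pq}\,d\theta_p\wedge d\theta_q+\sum\frac{\partial^2W}{\partial\theta_p\partial\theta_q}\,d\theta_p\wedge dz_q+\sum\frac{\partial^2W}{\partial z_p\partial\theta_q}\,dz_p\wedge dz_q.$$ For $\epsilon\in\mathbb{C}^*\cup\{\infty\}$ the twistor fibre $Z_\epsilon$ is the space of leaves of the foliation $\mathrm{im}(h_\epsilon)\subset T_X$, with quotient map $q_\epsilon\colon X\to Z_\epsilon$; also $Z_0=M$ and $q_0=\pi$. These leaf spaces are treated as complex manifolds (equivalently, all objects on $Z_\epsilon$ may be viewed as objects on $X$ descending along the foliation). There are symplectic forms $\Omega_\epsilon$ on $Z_\epsilon$ with $q_\epsilon^*(\Omega_\epsilon)=\epsilon^{-2}\Omega_++2i\epsilon^{-1}\Omega_I+\Omega_-$ for $\epsilon\in\mathbb{C}^*$,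 $q_\infty^*(\Omega_\infty)=\Omega_-$, and $\Omega_0=\omega$, $q_0^*(\Omega_0)=\Omega_+$. The vector field $E$ induces vector fields, also denoted $E$, on $Z_0$ and $Z_\infty$; $\mathcal{L}_E$ is the Lie derivative. The symplectic potentials are locally-defined 1-forms: $\Theta_0$ on $Z_0$ with $d\Theta_0=\Omega_0$, $\mathcal{L}_E(\Theta_0)=2\Theta_0$; $\Theta_1$ on $Z_1$ with $d\Theta_1=\Omega_1$; $\Theta_\infty$ on $Z_\infty$ with $d\Theta_\infty=\Omega_\infty$, $\mathcal{L}_E(\Theta_\infty)=0$. The flipped potential for $2i\Omega_I$ is $$2i\Theta_I'=-\sum_{p,q}\omega_{pq}\,\theta_p\,dz_q,\qquad d(2i\Theta_I')=2i\Omega_I.$$ The $\tau$-function is a locally-defined function on $X$, unique up to multiplication by constants. Generating function: if $\phi\colon(S,\Omega_S)\to(S',\Omega_{S'})$ satisfies $\phi^*\Omega_{S'}=\Omega_S$ and $\Theta,\Theta'$ are symplectic potentials for $\Omega_S,\Omega_{S'}$, the generating function of $\phi$ with respect to them is a locally-defined function $K$ with $dK=\Theta-\phi^*\Theta'$. All statements are local, on the domains where the chosen potentials are defined. *)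

(* Defs.v *)
From HB Require Import structures.
From mathcomp Require Import all_boot all_order all_algebra.
From mathcomp Require Import all_classical all_reals all_analysis.
From mathcomp Require Import complex.
Set Implicit Arguments.
Unset Strict Implicit.
Unset Printing Implicit Defensive.
Import Order.TTheory GRing.Theory Num.Theory numFieldNormedType.Exports.
Local Open Scope classical_set_scope.
Local Open Scope ring_scope.
Local Open Scope complex_scope.

(** * Holomorphic maps *)

Section Holomorphic.
Variables (R : realType) (V W : normedModType R[i]).

Fixpoint Cdiff (k : nat) (D : set V) (f : V -> W) : Prop :=
  (forall x, D x -> differentiable f x) /\
  (if k is k'.+1 then forall v : V, Cdiff k' D ('D_v f) else True).

(* On an open set, complex differentiability of all orders; by Cauchy's theorem
   order one already suffices in finite dimension. *)
Definition holomorphic_on (D : set V) (f : V -> W) : Prop :=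
  forall k, Cdiff k D f.

End Holomorphic.

(** * Complex manifolds given by atlases

   [crd a : dom a -> V] is a chart with inverse [par a]; the topology is the one
   generated by the atlas.  Every point has a preferred chart [ctr x], and the
   tangent space at [x] is the model space [V], a tangent vector being
   represented by its components in the preferred chart of [x].  The Hausdorff
   and countability axioms are not imposed (leaf spaces may fail them). *)

Record mfd (R : realType) (V : normedModType R[i]) := Mfd {
  pt :> Type;
  idx : Type;
  dom : idx -> set pt;
  crd : idx -> pt -> V;
  par : idx -> V -> pt;
  ctr : pt -> idx }.
Arguments dom {R V X} a : rename.
Arguments crd {R V X} a x : rename.
Arguments par {R V X} a z : rename.
Arguments ctr {R V X} x : rename.

Section Manifolds.
Variable R : realType.
Local Notation C := (R[i]).

Definition is_mfd (V : normedModType C) (X : mfd V) : Prop :=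
  [/\ forall x : X, dom (ctr x) x,
      forall (a : idx X) (x : X), dom a x -> par a (crd a x) = x,
      forall a b : idx X, open (crd a @` (dom a `&` dom b)) &
      forall a b : idx X,
        holomorphic_on (crd a @` (dom a `&` dom b)) (crd b \o par a)].

Definition mopen (V : normedModType C) (X : mfd V) (O : set X) : Prop :=
  forall a : idx X, open (crd a @` (dom a `&` O)).

(* A vector space as a manifold with one chart. *)
Definition flat (V : normedModType C) : mfd V :=
  @Mfd R V V unit (fun=> setT) (fun=> id) (fun=> id) (fun=> tt).

Section OneManifold.
Variables (V : normedModType C) (X : mfd V).

(* Components in the chart [a] of a tangent vector at [x], and conversely the
   tangent vector at [x] with given components in the chart [a]. *)
Definition tcrd (a : idx X) (x : X) (v : V) : V :=
  'd (crd a \o par (ctr x)) (crd (ctr x) x) v.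
Definition tpar (a : idx X) (x : X) (v : V) : V :=
  'd (crd (ctr x) \o par a) (crd a x) v.

Definition vfield := X -> V.
Definition form1 := X -> V -> C^o.
Definition form2 := X -> V -> V -> C^o.

(* Coordinate expressions in the chart [a]. *)
Definition vfield_in (E : vfield) (a : idx X) (z : V) : V :=
  tcrd a (par a z) (E (par a z)).
Definition form1_in (al : form1) (a : idx X) (z v : V) : C^o :=
  al (par a z) (tpar a (par a z) v).
Definition form2_in (Om : form2) (a : idx X) (z u v : V) : C^o :=
  Om (par a z) (tpar a (par a z) u) (tpar a (par a z) v).

Definition holo_form1 (O : set X) (al : form1) : Prop :=
  (forall x, O x -> forall (c : C) u v,
     al x (c *: u + v) = c * al x u + al x v) /\
  (forall (a : idx X) v,
     holomorphic_on (crd a @` (dom a `&` O)) (fun z => form1_in al a z v)).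

Definition holo_form2 (Om : form2) : Prop :=
  [/\ forall x (c : C) u v w,
        Om x (c *: u + v) w = c * Om x u w + Om x v w,
      forall x u v, Om x u v = - Om x v u &
      forall (a : idx X) u v,
        holomorphic_on (crd a @` dom a) (fun z => form2_in Om a z u v)].

(* The exterior and Lie derivatives are computed in the preferred chart; they
   do not depend on the chart. *)
Definition extd1 (al : form1) : form2 := fun x u v =>
  let a := ctr x in let z := crd a x in
  'D_u (fun y => form1_in al a y v) z - 'D_v (fun y => form1_in al a y u) z.

Definition extd2 (Om : form2) (x : X) (u v w : V) : C^o :=
  let a := ctr x in let z := crd a x in
  'D_u (fun y => form2_in Om a y v w) z + 'D_v (fun y => form2_in Om a y w u) z
  + 'D_w (fun y => form2_in Om a y u v) z.

Definition lie1 (E : vfield) (al : form1) : form1 := fun x v =>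
  let a := ctr x in let z := crd a x in
  'D_(vfield_in E a z) (fun y => form1_in al a y v) z
  + form1_in al a z ('D_v (vfield_in E a) z).

Definition symplectic_form (Om : form2) : Prop :=
  [/\ holo_form2 Om,
      forall x u v w, extd2 Om x u v w = 0 &
      forall x u, (forall v, Om x u v = 0) -> u = 0].

Definition symplectic_potential (Om : form2) (U : set X) (Th : form1) : Prop :=
  [/\ mopen U, holo_form1 U Th &
      forall x, U x -> forall u v, extd1 Th x u v = Om x u v].

Definition wedge (al be : form1) : form2 := fun x u v =>
  al x u * be x v - al x v * be x u.

End OneManifold.

Section Maps.
Variables (V W : normedModType C) (X : mfd V) (Y : mfd W).

Definition mholo (O : set X) (f : X -> Y) : Prop :=
  forall (a : idx X) (b : idx Y),
    let D := crd a @` (dom a `&` (O `&` (f @^-1` dom b))) in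
    open D /\ holomorphic_on D (crd b \o f \o par a).

Definition mdiff (f : X -> Y) (x : X) (v : V) : W :=
  'd (crd (ctr (f x)) \o f \o par (ctr x)) (crd (ctr x) x) v.

Definition pull1 (f : X -> Y) (al : form1 Y) : form1 X :=
  fun x v => al (f x) (mdiff f x v).
Definition pull2 (f : X -> Y) (Om : form2 Y) : form2 X :=
  fun x u v => Om (f x) (mdiff f x u) (mdiff f x v).

Definition symplectic_map (Om : form2 X) (Om' : form2 Y) (f : X -> Y) : Prop :=
  mholo setT f /\ forall x u v, pull2 f Om' x u v = Om x u v.

End Maps.

Section Functions.
Variables (V : normedModType C) (X : mfd V).

Definition holo_fun (O : set X) (f : X -> C^o) : Prop :=
  @mholo V C^o X (flat C^o) O f.

Definition dfun (f : X -> C^o) : form1 X := @mdiff V C^o X (flat C^o) f.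

Definition dlog (f : X -> C^o) : form1 X := fun x v => dfun f x v / f x.

Definition cexp (w : C) : C :=
  let: a +i* b := w in (expR a * cos b) +i* (expR a * sin b).

Definition log_branch (O : set X) (K f : X -> C^o) : Prop :=
  holo_fun O K /\ forall x, O x -> cexp (K x) = f x.

End Functions.

(* [K], defined on the open set [D], is a generating function of [phi] with
   respect to the potentials [Th] on [U] and [Th'] on [U']. *)
Definition generating_function (V W : normedModType C) (S : mfd V) (S' : mfd W)
    (Om : form2 S) (Om' : form2 S') (phi : S -> S')
    (U : set S) (Th : form1 S) (U' : set S') (Th' : form1 S')
    (D : set S) (K : S -> C^o) : Prop :=
  [/\ symplectic_form Om /\ symplectic_form Om',
      symplectic_map Om Om' phi,
      symplectic_potential Om U Th /\ symplectic_potential Om' U' Th',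
      [/\ mopen D, D `<=` U, D `<=` phi @^-1` U' & holo_fun D K] &
      forall x, D x -> forall v, dfun K x v = Th x v - pull1 phi Th' x v].

(** * Leaf spaces *)

(* [Dist x w] means that [w] is tangent at [x] to the distribution.  Leaves are
   the classes of points joined by chains of tangent holomorphic curves. *)
Inductive same_leaf (V : normedModType C) (X : mfd V) (Dist : X -> set V) :
    X -> X -> Prop :=
| leaf_refl x : same_leaf Dist x x
| leaf_step x (B : set C^o) (c : C^o -> X) (s t : C^o) :
    same_leaf Dist x (c s) ->
    open B -> connected B -> B s -> B t ->
    @mholo C^o V (flat C^o) X B c ->
    (forall r, B r -> Dist (c r) (@mdiff C^o V (flat C^o) X c r 1)) ->
    same_leaf Dist x (c t).

Definition is_leaf_space (V W : normedModType C) (X : mfd V)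
    (Dist : X -> set V) (Z : mfd W) (q : X -> Z) : Prop :=
  [/\ is_mfd Z /\ mholo setT q,
      forall z, exists x, q x = z,
      forall x w, exists v, mdiff q x v = w,
      forall x v, mdiff q x v = 0 <-> Dist x v &
      forall x y, q x = q y <-> same_leaf Dist x y].

(** * Tangent bundle and Joyce structures *)

Section Joyce.
Variable n : nat.
Local Notation V := 'rV[C]_n.

(* A point is a pair of a point of [M] and a tangent vector there; a chart of
   [M] induces the chart with co-ordinates [(z, theta)]. *)
Definition tangent_bundle (M : mfd V) : mfd (V * V)%type :=
  @Mfd R (V * V)%type (M * V)%type (idx M)
    (fun a => [set x | dom a x.1])
    (fun a x => (crd a x.1, tcrd a x.1 x.2))
    (fun a zt => (par a zt.1, tpar a (par a zt.1) zt.2))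
    (fun x => ctr x.1).

Definition bundle_proj (M : mfd V) : tangent_bundle M -> M := fst.

(* The fibre over [p] is the vector space [T_p M]. *)
Definition fibre_incl (M : mfd V) (p : M) : flat V -> tangent_bundle M :=
  fun th => (p, th).

(* The complex structure of [M] is the one generated by the distinguished
   charts, so these form the atlas of [M]. *)
Definition is_period_structure (M : mfd V) : Prop :=
  is_mfd M /\
  forall (a b : idx M) (x : M), dom a x -> dom b x ->
    exists2 A : 'M[int]_n, A \in unitmx &
      \forall z \near crd a x, crd b (par a z) = z *m map_mx intr A.

(* Components of [u] in the integral linear co-ordinates [a], as 1-forms. *)
Definition dz (M : mfd V) (a : idx M) (p : 'I_n) : form1 (tangent_bundle M) :=
  fun x u => (@tcrd _ (tangent_bundle M) a x u).1 ord0 p.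
Definition dth (M : mfd V) (a : idx M) (p : 'I_n) : form1 (tangent_bundle M) :=
  fun x u => (@tcrd _ (tangent_bundle M) a x u).2 ord0 p.
Definition dz0 (M : mfd V) (a : idx M) (p : 'I_n) : form1 M :=
  fun x u => (tcrd a x u) ord0 p.
(* On the fibre over [p0], where [theta] are linear co-ordinates. *)
Definition dthF (M : mfd V) (p0 : M) (a : idx M) (p : 'I_n) : form1 (flat V) :=
  fun _ u => (tcrd a p0 u) ord0 p.

Definition basis_vec (i : 'I_n) : V := delta_mx ord0 i.

Definition pz (i : 'I_n) (f : V * V -> C^o) : V * V -> C^o :=
  'D_((basis_vec i, 0) : V * V) f.
Definition pth (i : 'I_n) (f : V * V -> C^o) : V * V -> C^o :=
  'D_((0, basis_vec i) : V * V) f.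

Definition twopii : C := 2 * pi%:C * 'i.

(* [W a] is the function W in the chart [a]: the normalisation along theta = 0
   determines it on the whole of [crd a (dom a) x C^n].  The relation to the
   globally defined [h] makes the [W a] for different charts compatible. *)
Record joyce_structure (M : mfd V) := JoyceStructure {
  omega : form2 M;
  om : idx M -> 'M[C]_n;
  eta : idx M -> 'M[C]_n := fun a => invmx (om a);
  hconn : tangent_bundle M -> V -> V * V;
  W : idx M -> V * V -> C^o;
  J_period : is_period_structure M;
  J_symplectic : symplectic_form omega;
  J_om : forall a : idx M,
    (om a)^T = - om a /\
    forall x, dom a x -> forall u v,
      omega x u v
      = 2^-1 * \sum_p \sum_q om a p q * wedge (dz0 a p) (dz0 a q) x u v;
  J_eta : forall a : idx M, om a \in unitmx /\
    forall p q, exists m : int, eta a p q = twopii * m%:~R;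
  J_h_linear : forall x (c : C) u v,
    hconn x (c *: u + v) = c *: hconn x u + hconn x v;
  J_W_holo : forall a : idx M,
    holomorphic_on [set zt | (crd a @` dom a) zt.1] (W a);
  J_h : forall (a : idx M) (x : tangent_bundle M), dom a x.1 -> forall i,
    @tcrd _ (tangent_bundle M) a x (hconn x (tpar a x.1 (basis_vec i)))
    = (basis_vec i,
       \sum_p \sum_q (eta a p q * pth i (pth p (W a)) (@crd _ _ (tangent_bundle M) a x))
                       *: basis_vec q);
  J_normal : forall (a : idx M) z, (crd a @` dom a) z ->
    W a (z, 0) = 0 /\ forall i, pth i (W a) (z, 0) = 0;
  J_pde : forall (a : idx M) zt, (crd a @` dom a) zt.1 -> forall i j,
    pth i (pz j (W a)) zt - pth j (pz i (W a)) zt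
    = \sum_p \sum_q eta a p q * pth i (pth p (W a)) zt * pth j (pth q (W a)) zt;
  J_periodic : forall (a : idx M) z th (k : 'rV[int]_n), (crd a @` dom a) z ->
    forall i j,
    pth i (pth j (W a)) (z, th + twopii *: map_mx intr k)
    = pth i (pth j (W a)) (z, th);
  J_homogeneous : forall (a : idx M) z th (lam : C), lam != 0 ->
    (crd a @` dom a) z -> (crd a @` dom a) (lam *: z) ->
    W a (lam *: z, th) = lam^-1 * W a (z, th);
  J_odd : forall (a : idx M) z th, (crd a @` dom a) z ->
    W a (z, - th) = - W a (z, th) }.

(* Euler fields, written in the preferred chart; the formula is the same in
   every integral linear chart since the transition maps are linear. *)
Definition euler_base (M : mfd V) : vfield M := fun x => crd (ctr x) x.
Definition euler_total (M : mfd V) : vfield (tangent_bundle M) :=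
  fun x => (crd (ctr x.1) x.1, 0).

Section Forms.
Variables (M : mfd V) (J : joyce_structure M).
Local Notation X := (tangent_bundle M).
(* The formulas below are chart independent, and are evaluated at [x] in the
   integral linear co-ordinates of the preferred chart. *)

Definition Omega_plus : form2 X := fun x u v =>
  let a := ctr x in
  2^-1 * \sum_p \sum_q om J a p q * wedge (dz a p) (dz a q) x u v.

Definition Omega_I : form2 X := fun x u v =>
  let a := ctr x in
  (2 * 'i)^-1 * - \sum_p \sum_q om J a p q * wedge (dz a p) (dth a q) x u v.

Definition Omega_minus : form2 X := fun x u v =>
  let a := ctr x in let zt := crd a x in
  2^-1 * (\sum_p \sum_q om J a p q * wedge (dth a p) (dth a q) x u v)
  + \sum_p \sum_q pth p (pth q (W J a)) zt * wedge (dth a p) (dz a q) x u v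
  + \sum_p \sum_q pz p (pth q (W J a)) zt * wedge (dz a p) (dz a q) x u v.

Definition Theta_I_flip : form1 X := fun x u =>
  let a := ctr x in
  (2 * 'i)^-1 * - \sum_p \sum_q om J a p q * (crd a x).2 ord0 p * dz a q x u.

(* In the preferred chart of a point (x, theta) of [X], the vertical lift of
   [u] is [(0, u)].  The parameter [t] is the inverse of epsilon, so that
   [t = 0] is epsilon = infinity. *)
Definition im_h (t : C) : X -> set (V * V)%type := fun x w =>
  exists u : V, w = hconn J x u + t *: ((0, u) : V * V).

Record twistor_fibre (t : C) := TwistorFibre {
  Zspace :> mfd V;
  qmap : X -> Zspace;
  Omega_Z : form2 Zspace;
  Z_leaf_space : is_leaf_space (im_h t) qmap;
  Z_symplectic : symplectic_form Omega_Z;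
  Z_pullback : forall x u v, pull2 qmap Omega_Z x u v
    = t ^+ 2 * Omega_plus x u v + 2 * 'i * t * Omega_I x u v
      + Omega_minus x u v }.

End Forms.
End Joyce.
End Manifolds.
Arguments fibre_incl {R n M} p th.
Arguments bundle_proj {R n} M x.
Arguments qmap {R n M J t} Z x : rename.
Arguments Omega_Z {R n M J t} Z x u v : rename.
Arguments omega {R n M} J x u v : rename.

(* Main.v *)
Require Import Defs.
From HB Require Import structures.
From mathcomp Require Import all_boot all_order all_algebra.
From mathcomp Require Import all_classical all_reals all_analysis.
From mathcomp Require Import complex.
From mathcomp Require Import ring lra.
Import Order.TTheory GRing.Theory Num.Theory numFieldNormedType.Exports.
Set Implicit Arguments.
Unset Strict Implicit.
Unset Printing Implicit Defensive.
Local Open Scope classical_set_scope.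
Local Open Scope ring_scope.

(** Vectors tangent to a fibre [F] of the tangent bundle are vertical, so every
    term containing a factor [dz] vanishes on them.

    The forms [Omega_plus] and [Omega_I] restrict to zero on [F], and only the
    term in [dtheta /\ dtheta] of [Omega_minus] survives. Hence every form
    [epsilon^-2 Omega_plus + 2 i epsilon^-1 Omega_I + Omega_minus] restricts to
    the same constant form, the linear symplectic form given by [omega], and all
    the quotient maps to the twistor fibres are symplectic on [F]
    ([twistor_vertical], [pull2_twistor_fibre]).

    The flipped potential is a combination of the [dz], and the pullback of
    [Theta0] factors through the differential of the projection to the base, so
    both vanish on [F]. Restricting the formula for [dlog tau] by the chain rule
    ([mdiff_comp_fibre]) leaves the two terms from [Theta_infinity] and [Theta_1].

    The restriction of [Theta_infinity] is a potential because exterior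
    differentiation commutes with pullback ([symplectic_potential_pull]). In
    charts this is the symmetry of the second derivatives of the map, which
    [derive_comm] proves for complex differentiable functions by applying the
    real mean value theorem to real parts. Its holomorphy rests on the closure of
    iterated complex differentiability under sums, products and composition.

    Finally a branch [K] of [log tau] satisfies [dK = dlog tau], since the complex
    exponential, given by its real and imaginary parts, is its own complex
    derivative ([is_derive_cexp], [dlog_log_branch]). This identifies [K] as the
    generating function. *)

(** * Symmetry of second derivatives *)

Section RealLines.
Local Open Scope complex_scope.

Lemma pos_complexE (R : realType) (e : R[i]) : 0 < e -> e = (complex.Re e)%:C.
Proof. by move=> e0; rewrite RRe_real // gtr0_real. Qed.

Lemma pos_Re (R : realType) (e : R[i]) : 0 < e -> 0 < complex.Re e.
Proof. by rewrite ltcE /= => /andP[]. Qed.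

Lemma norm_realC (R : realType) (r : R) : `|r%:C| = `|r|%:C :> R[i].
Proof. by rewrite normc_def /= expr0n /= addr0 sqrtr_sqr. Qed.

Lemma cvg_realC_dnbhs (R : realType) :
  (fun r : R^o => r%:C : R[i]^o) @ (0 : R^o)^' --> (0 : R[i]^o)^'.
Proof.
move=> P; rewrite /= !/(nbhs _ _) /= /within /= => /nbhs_ballP[e /= e0 eP].
apply/nbhs_ballP; exists (complex.Re e); first exact: pos_Re.
move=> r /=; rewrite /ball /= sub0r normrN => hr rn0; apply: eP.
  by rewrite /ball /= sub0r normrN norm_realC (pos_complexE e0) ltcR.
by apply: contra rn0 => /eqP[->].
Qed.

Lemma continuous_ReM (R : realType) (c : R[i]) :
  continuous (fun z : R[i]^o => complex.Re (c * z) : R^o).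
Proof.
move=> z; apply/(@cvgrPdist_lt _ R^o _ (nbhs (z : R[i]^o))) => e e0.
have c1 : 0 < `|c| + 1 by rewrite ltr_wpDl.
apply/nbhs_ballP; exists (e%:C / (`|c| + 1)) => /=.
  by rewrite divr_gt0 // ltcR.
move=> w; rewrite /ball /= ltr_pdivlMr // mulrC => hw.
rewrite -raddfB -mulrBr -ltcR; apply: le_lt_trans (normc_ge_Re _) _.
by rewrite normrM; apply: le_lt_trans hw; rewrite ler_wpM2r // lerDl.
Qed.

(** Complex-valued functions are studied along real lines through the real
    functions [Re (c * f)], to which the real mean value theorem applies; a
    suitable constant [c] recovers any component of the value. *)
Lemma real_line_is_derive (R : realType) (V : normedModType R[i]) (f : V -> R[i]^o)
    (x u : V) (c : R[i]) (r : R) :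
  differentiable f (x + r%:C *: u) ->
  is_derive (r : R^o) (1 : R^o)
    (fun s : R^o => complex.Re (c * f (x + s%:C *: u)) : R^o)
    (complex.Re (c * 'D_u f (x + r%:C *: u))).
Proof.
move=> df.
set d := 'D_u f _; set F := fun s : R^o => _.
have H : (fun h : R^o => h^-1 *: ((F \o shift (r : R^o)) (h *: (1 : R^o)) - F r))
    @ 0^' --> (complex.Re (c * d) : R^o).
  have fd : derivable f (x + r%:C *: u) u by exact: diff_derivable.
  have := cvg_comp _ _ (@cvg_realC_dnbhs R) (cvg_comp _ _ fd (@continuous_ReM R c d)).
  apply: cvg_trans; apply: near_eq_cvg; near=> h.
  rewrite /F /= /GRing.scale /= mulr1.
  rewrite (_ : h%:C *: u + (x + r%:C *: u) = x + (h + r)%:C *: u); last first.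
    by rewrite rmorphD scalerDl addrCA.
  rewrite -raddfB -mulrBr -fmorphV mulrCA.
  by case: (c * _) => a b /=; simpc.
by apply: DeriveDef; [exact: cvgP H | exact: cvg_lim H].
Unshelve. all: by end_near. Qed.

(** By the mean value theorem on the segment of direction [u], the real part is
    [s] times that of [c] times the increment of [D_u f] in the direction
    [s *: v] at some intermediate point, and differentiability of [D_u f] at [x] compares this
    increment with [s * d2], up to [o(s)] uniformly in the intermediate point. *)
Lemma second_difference (R : realType) (V : normedModType R[i]) (f : V -> R[i]^o)
    (x u v : V) (c d2 : R[i]) (e : R) :
  (\forall y \near x, differentiable f y) ->
  differentiable ('D_u f) x -> 'D_v ('D_u f) x = d2 -> 0 < e ->
  exists2 d : R, 0 < d & forall s : R, 0 < s -> s < d ->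
    `|complex.Re (c * (f (x + s%:C *: v + s%:C *: u) - f (x + s%:C *: u)
                       - f (x + s%:C *: v) + f x))
      - s ^+ 2 * complex.Re (c * d2)| <= e * s ^+ 2.
Proof.
move=> nf dg <- e0.
(* The remainder of 'D_u f is evaluated at r u + s v and r u with 0 <= r <= s,
   two vectors whose norms add up to at most s B. *)
set g := 'D_u f; set B := 2 * `|u| + `|v| + 1.
have B0 : 0 < B by rewrite ltr_wpDl // addr_ge0 // mulr_ge0.
have uB : `|u| <= B.
  have -> : B = `|u| + (`|u| + `|v| + 1) by rewrite /B; ring.
  by rewrite lerDl !addr_ge0.
have uvB : `|u| + `|v| <= B.
  have -> : B = `|u| + `|v| + (`|u| + 1) by rewrite /B; ring.
  by rewrite lerDl !addr_ge0.
have c0 : 0 < `|c| + 1 by rewrite ltr_wpDl.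
pose e' := e%:C / ((`|c| + 1) * B).
have e'0 : 0 < e' by rewrite divr_gt0 ?mulr_gt0 // ltcR.
have : \forall h \near (0 : V), differentiable f (h + x) /\
    `|g (h + x) - g x - 'd g x h| <= e' * `|h|.
  near=> h; split.
    near: h; move: nf; rewrite (near_shift 0 x) /=; apply: filterS => h /=.
    by rewrite subr0.
  near: h.
  have /eqaddoP := diff_locally dg; move=> /(_ e' e'0); apply: filterS => h /=.
  by rewrite /= !fctE opprD addrA.
move=> /nbhs_ballP[del /= del0 Hdel].
have dB0 : 0 < del / B by rewrite divr_gt0.
exists (complex.Re (del / B)); first exact: pos_Re.
move=> s s0 sd.
have sB : s%:C * B < del by rewrite -ltr_pdivlMr // (pos_complexE dB0) ltcR.
have s0C : 0 < s%:C :> R[i] by rewrite ltcR.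
have bnd r : 0 <= r -> r <= s -> r%:C * `|u| <= s%:C * `|u| :> R[i].
  by move=> r0 rs; rewrite ler_wpM2r // lecR.
(* Points of the parallelogram stay in the ball where the estimates hold. *)
have in1 r : 0 <= r -> r <= s -> ball (0 : V) del (r%:C *: u).
  move=> r0 rs; rewrite -ball_normE /ball_ /= sub0r normrN normrZ norm_realC ger0_norm //.
  apply: le_lt_trans (bnd _ r0 rs) _; apply: le_lt_trans sB.
  by rewrite ler_wpM2l // ltW.
have in2 r : 0 <= r -> r <= s -> ball (0 : V) del (r%:C *: u + s%:C *: v).
  move=> r0 rs; rewrite -ball_normE /ball_ /= sub0r normrN.
  apply: le_lt_trans (ler_normD _ _) _; rewrite !normrZ !norm_realC ger0_norm // gtr0_norm //.
  apply: le_lt_trans (lerD (bnd _ r0 rs) (lexx _)) _; apply: le_lt_trans sB.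
  by rewrite -mulrDr ler_wpM2l // ltW.
pose F1 := fun r : R^o => complex.Re (c * f (x + s%:C *: v + r%:C *: u)) : R^o.
pose F0 := fun r : R^o => complex.Re (c * f (x + r%:C *: u)) : R^o.
pose G := fun r : R => complex.Re (c * g (x + s%:C *: v + r%:C *: u))
                       - complex.Re (c * g (x + r%:C *: u)).
have dF (t : R) : 0 <= t -> t <= s -> is_derive (t : R^o) (1 : R^o) (F1 - F0) (G t).
  move=> r0 rs; apply: is_deriveB; apply: real_line_is_derive.
    have [+ _] := Hdel _ (in2 _ r0 rs).
    by rewrite addrC addrA addrAC -!addrA addrC -!addrA.
  by have [+ _] := Hdel _ (in1 _ r0 rs); rewrite addrC.
have cF : {within `[0, s], continuous (F1 - F0)}.
  apply: derivable_within_continuous => r; rewrite in_itv /= => /andP[r0 rs].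
  by have [] := dF _ r0 rs.
have dF' t : t \in `]0, s[%R -> is_derive (t : R^o) (1 : R^o) (F1 - F0) (G t).
  by rewrite in_itv /= => /andP[t0 ts]; apply: dF; exact: ltW.
have [r] := MVT s0 dF' cF.
rewrite in_itv /= => /andP[r0 rs].
rewrite subr0 !fctE => E.
have -> : complex.Re (c * (f (x + s%:C *: v + s%:C *: u) - f (x + s%:C *: u)
                       - f (x + s%:C *: v) + f x)) = G r * s.
  rewrite -E /F1 /F0 !scale0r !addr0 -!raddfB; congr (complex.Re _).
  rewrite -!mulrBr; congr (_ * _). by rewrite opprB addrA [RHS]addrAC.
have [_ h1] := Hdel _ (in1 _ (ltW r0) (ltW rs)).
have [_ h2] := Hdel _ (in2 _ (ltW r0) (ltW rs)).
rewrite expr2 -mulrA (mulrC (G r)) -mulrBr normrM (gtr0_norm s0) mulrCA ler_pM2l //.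
have -> : G r - s * complex.Re (c * 'D_v g x) = complex.Re (c * (
   (g (r%:C *: u + s%:C *: v + x) - g x - 'd g x (r%:C *: u + s%:C *: v))
   - (g (r%:C *: u + x) - g x - 'd g x (r%:C *: u)))).
  have reM (z : R[i]) : s * complex.Re z = complex.Re (s%:C * z).
    by case: z => p q /=; simpc.
  have ReB (y z : R[i]) : complex.Re y - complex.Re z = complex.Re (y - z).
    by rewrite raddfB.
  have -> : 'd g x (r%:C *: u + s%:C *: v) = 'd g x (r%:C *: u) + s%:C * 'D_v g x.
    by rewrite (deriveE _ dg) linearD; congr (_ + _); rewrite linearZ.
  rewrite /G reM !ReB [x + r%:C *: u]addrC.
  have -> : x + s%:C *: v + r%:C *: u = r%:C *: u + s%:C *: v + x.
    by rewrite -addrA addrC; congr (_ + _); rewrite addrC.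
  have alg (a b g0 k l : R[i]) :
    c * a - c * b - s%:C * (c * k) = c * ((a - g0 - (l + s%:C * k)) - (b - g0 - l)).
    by ring.
  by congr (complex.Re _); exact: alg.
rewrite -lecR; apply: le_trans (normc_ge_Re _) _; rewrite normrM.
apply: (@le_trans _ _ ((`|c| + 1) * (e' * (s%:C * B)))); last first.
  rewrite /e' rmorphM.
  have -> : (`|c| + 1) * (e%:C / ((`|c| + 1) * B) * (s%:C * B)) = e%:C * s%:C; last by [].
  by field; rewrite !gt_eqF.
apply: ler_pM => //; first by rewrite lerDl.
apply: le_trans (ler_normB _ _) _; apply: le_trans (lerD h2 h1) _.
rewrite -mulrDr ler_wpM2l ?(ltW e'0) //.
apply: (@le_trans _ _ ((s%:C * `|u| + s%:C * `|v|) + s%:C * `|u|)).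
  apply: lerD; last by rewrite normrZ norm_realC (gtr0_norm r0) bnd // ltW.
  apply: le_trans (ler_normD _ _) _; rewrite !normrZ !norm_realC !gtr0_norm //.
  by rewrite lerD2r bnd // ltW.
rewrite -!mulrDr ler_wpM2l ?(ltW s0C) // /B.
have -> : 2 * `|u| + `|v| + 1 = `|u| + `|v| + `|u| + 1 by ring.
by rewrite lerDl.
Unshelve. all: by end_near. Qed.

(** Both mixed derivatives are the limit of the same second difference divided
    by the square of the side; pairing with the conjugate of their difference
    reduces the equality to one between real parts. *)
Lemma derive_comm (R : realType) (V : normedModType R[i]) (f : V -> R[i]^o)
    (x u v : V) :
  (\forall y \near x, differentiable f y) ->
  differentiable ('D_u f) x -> differentiable ('D_v f) x ->
  'D_v ('D_u f) x = 'D_u ('D_v f) x.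
Proof.
move=> nf du dv.
suff key (a b : R[i]) : 'D_v ('D_u f) x = a -> 'D_u ('D_v f) x = b -> a = b.
  exact: key.
move=> Ea Eb.
(* With this c the product c * (a - b) is the real number |a - b|^2. *)
pose c := (a - b)^*%C.
suff H : complex.Re (c * a) = complex.Re (c * b).
  have n2 : `|a - b| ^+ 2 = 0.
    rewrite -[LHS]RRe_real; last by rewrite realX // normr_real.
    by rewrite sqr_normc mulrC -/c mulrBr raddfB /= H subrr.
  by move/eqP: n2; rewrite expf_eq0 /= normr_eq0 subr_eq0 => /eqP.
apply/eqP; rewrite -subr_eq0 -normr_le0; apply/ler_addgt0Pl => e e0.
have e2 : 0 < e / 2 by rewrite divr_gt0.
have [d1 d10 H1] := second_difference c nf du Ea e2.
have [d2 d20 H2] := second_difference c nf dv Eb e2.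
pose s := Num.min d1 d2 / 2.
have m0 : 0 < Num.min d1 d2 by rewrite lt_min d10.
have s0 : 0 < s by rewrite divr_gt0.
have sm : s < Num.min d1 d2 by rewrite ltr_pdivrMr // mulr_natr mulr2n ltrDl.
move: sm; rewrite lt_min => /andP[sd1 sd2].
move: (H1 s s0 sd1) (H2 s s0 sd2).
have -> : f (x + s%:C *: u + s%:C *: v) - f (x + s%:C *: v) - f (x + s%:C *: u) + f x
  = f (x + s%:C *: v + s%:C *: u) - f (x + s%:C *: u) - f (x + s%:C *: v) + f x.
  by congr (_ + _); rewrite [LHS]addrAC (addrAC x).
set D := complex.Re (c * (_ + _)).
move=> h1 h2; have s20 : 0 < s ^+ 2 by rewrite exprn_gt0.
rewrite addr0 -(ler_pM2r s20) -{1}(gtr0_norm s20) -normrM.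
have -> : (complex.Re (c * a) - complex.Re (c * b)) * s ^+ 2 =
  (D - s ^+ 2 * complex.Re (c * b)) - (D - s ^+ 2 * complex.Re (c * a)) by ring.
apply: le_trans (ler_normB _ _) _; apply: le_trans (lerD h2 h1) _.
by rewrite -mulrDl -splitr.
Qed.

End RealLines.

(** * The complex exponential *)

Section ComplexExponential.
Local Open Scope complex_scope.

Lemma derive_remainder (R : realType) (f : R^o -> R^o) (d e : R) :
  is_derive (0 : R^o) (1 : R^o) f d -> 0 < e ->
  \forall a \near (0 : R^o), `|f a - f 0 - d * a| <= e * `|a|.
Proof.
move=> [df dE] e0.
have /eqaddoP := derivable_nbhs df; move=> /(_ e e0); apply: filterS => a /=.
rewrite !fctE /= addr0 dE opprD addrA /GRing.scale /= mulr1.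
by rewrite [a * d]mulrC.
Qed.

Lemma normc_ge_Im (R : realType) (z : R[i]) : `|complex.Im z|%:C <= `|z|.
Proof.
have -> : complex.Im z = - complex.Re (z * 'i) by rewrite ReiNIm opprK.
rewrite normrN; apply: le_trans (normc_ge_Re _) _.
by rewrite normrM [`|'i|]normc_def /= expr0n expr1n add0r sqrtr1 mulr1.
Qed.

Lemma normc_le_ReIm (R : realType) (z : R[i]) :
  `|z| <= (`|complex.Re z| + `|complex.Im z|)%:C.
Proof.
rewrite {1}(complexE z); apply: le_trans (ler_normD _ _) _.
rewrite normrM !norm_realC [`|'i|]normc_def /= expr0n expr1n add0r sqrtr1 mul1r.
by rewrite -rmorphD.
Qed.

Lemma near_Re_Im (R : realType) (P : set R) :
  (\forall a \near (0 : R^o), P a) ->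
  \forall h \near (0 : R[i]^o), P (complex.Re h) /\ P (complex.Im h).
Proof.
move=> nP.
have H (c : R[i]) : \forall h \near (0 : R[i]^o), P (complex.Re (c * h)).
  by apply: (@continuous_ReM R c 0); rewrite mulr0.
apply: filterS2 (H 1) (H (- 'i)) => h; rewrite mul1r => h1 h2; split=> //.
by move: h2; case: (h) => a b /=; simpc.
Qed.

Lemma cexpD (R : realType) (z w : R[i]) : cexp (z + w) = cexp z * cexp w.
Proof.
case: z w => [a b] [c d].
rewrite -[_ +i* _ + _]/((a + c) +i* (b + d)) /cexp.
rewrite expRD cosD sinD; apply/eqP; rewrite eq_complex /=.
by apply/andP; split; apply/eqP; ring.
Qed.

Lemma cexp_neq0 (R : realType) (z : R[i]) : cexp z != 0.
Proof.
apply/negP => /eqP E; have := cexpD z (- z); rewrite subrr E mul0r /cexp.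
by move=> /eqP; rewrite eq_complex /= expR0 cos0 mul1r oner_eq0.
Qed.

(** Near the origin the real and imaginary parts of the remainder are controlled
    by the first-order expansions of the real functions exp, cos and sin. *)
Lemma cexp_remainder (R : realType) (e : R) : 0 < e ->
  \forall h \near (0 : R[i]^o), `|cexp h - 1 - h| <= e%:C * `|h|.
Proof.
move=> e0.
(* Each of the two parts of the remainder is at most 3 k |h|; k <= 1 is used to
   bound the real exponential by 2. *)
pose k := Num.min (e / 6) 1.
have k0 : 0 < k by rewrite lt_min divr_gt0 //= ltr01.
have k1 : k <= 1 by rewrite ge_min lexx orbT.
have k6 : 6 * k <= e.
  by rewrite mulrC -ler_pdivlMr // ge_min lexx.
have nexp : \forall a \near (0 : R^o), `|expR a - 1 - a| <= k * `|a|.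
  have d : is_derive (0 : R^o) (1 : R^o) (expR : R^o -> R^o) 1.
    by rewrite -[X in is_derive _ _ _ X](@expR0 R); exact: is_derive_expR.
  by apply: filterS (derive_remainder d k0) => a; rewrite expR0 mul1r.
have ncos : \forall a \near (0 : R^o), `|cos a - 1| <= k * `|a|.
  have d : is_derive (0 : R^o) (1 : R^o) (cos : R^o -> R^o) 0.
    rewrite -[X in is_derive _ _ _ X]oppr0 -[X in - X](@sin0 R).
    exact: is_derive_cos.
  by apply: filterS (derive_remainder d k0) => a; rewrite cos0 mul0r subr0.
have nsin : \forall a \near (0 : R^o), `|sin a - a| <= k * `|a|.
  have d : is_derive (0 : R^o) (1 : R^o) (sin : R^o -> R^o) 1.
    by rewrite -[X in is_derive _ _ _ X](@cos0 R); exact: is_derive_sin.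
  by apply: filterS (derive_remainder d k0) => a; rewrite sin0 mul1r subr0.
have nk : \forall a \near (0 : R^o), `|a| <= k / 2.
  by apply: nbhs0_le; rewrite divr_gt0.
have nall : \forall a \near (0 : R^o), (`|expR a - 1 - a| <= k * `|a| /\
    `|cos a - 1| <= k * `|a|) /\ (`|sin a - a| <= k * `|a| /\ `|a| <= k / 2).
  exact: filterI (filterI nexp ncos) (filterI nsin nk).
move: (near_Re_Im nall).
apply: filterS => h [[[ea _] [_ na]] [[_ cb] [sb _]]].
move: ea na cb sb; case: h => a b /= ea na cb sb.
have e1 : `|expR a - 1| <= k.
  have -> : expR a - 1 = (expR a - 1 - a) + a by rewrite subrK.
  apply: le_trans (ler_normD _ _) _.
  have : k * `|a| <= 1 * `|a| by rewrite ler_wpM2r.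
  by move: ea na; lra.
have e2 : `|expR a| <= 2.
  have -> : expR a = (expR a - 1) + 1 by rewrite subrK.
  by apply: le_trans (ler_normD _ _) _; rewrite normr1; lra.
apply: le_trans (normc_le_ReIm _) _; rewrite /=.
have rA : `|expR a * cos b - 1 - a| <= k * `|a| + 2 * (k * `|b|).
  have -> : expR a * cos b - 1 - a = (expR a - 1 - a) + expR a * (cos b - 1) by ring.
  by apply: le_trans (ler_normD _ _) _; rewrite lerD // normrM ler_pM.
have rB : `|expR a * sin b - 0 - b| <= 2 * (k * `|b|) + k * `|b|.
  have -> : expR a * sin b - 0 - b = expR a * (sin b - b) + (expR a - 1) * b by ring.
  by apply: le_trans (ler_normD _ _) _; rewrite !normrM lerD // ler_pM.
have hA := @normc_ge_Re R (a +i* b); have hB := @normc_ge_Im R (a +i* b).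
move: hA hB; rewrite /= normc_def /= -rmorphM /= !lecR.
set N := Num.sqrt _ => hA hB.
have kA : k * `|a| <= k * N by rewrite ler_pM2l.
have kB : k * `|b| <= k * N by rewrite ler_pM2l.
have N0 : 0 <= N by exact: sqrtr_ge0.
have : (6 * k) * N <= e * N by rewrite ler_wpM2r.
by move: rA rB; lra.
Qed.

(** Since the exponential is a homomorphism, its derivative at [w] follows from
    the expansion at the origin. *)
Lemma is_derive_cexp (R : realType) (w : R[i]) :
  is_derive (w : R[i]^o) (1 : R[i]^o) (@cexp R : R[i]^o -> R[i]^o) (cexp w).
Proof.
have H : (fun h : R[i]^o => h^-1 *: (((@cexp R : R[i]^o -> R[i]^o) \o shift (w : R[i]^o))
    (h *: (1 : R[i]^o)) - cexp w)) @ 0^' --> (cexp w : R[i]^o).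
  apply/cvgrPdist_le => e e0.
  have c0 : 0 < `|cexp w| by rewrite normr_gt0 cexp_neq0.
  have ec0 : 0 < e / `|cexp w| by rewrite divr_gt0.
  have Hn := cexp_remainder (pos_Re ec0).
  rewrite near_withinE; move: Hn; apply: filterS => h hh hn0.
  rewrite /= /GRing.scale /= mulr1 cexpD.
  have -> : cexp w - h^-1 * (cexp h * cexp w - cexp w) =
     - (cexp w * h^-1 * (cexp h - 1 - h)) by field.
  rewrite normrN !normrM normfV; rewrite -(pos_complexE ec0) in hh.
  apply: (@le_trans _ _ (`|cexp w| / `|h| * (e / `|cexp w| * `|h|))).
    by rewrite ler_wpM2l // divr_ge0.
  have h0 : `|h| != 0 by rewrite normr_eq0.
  have -> : `|cexp w| / `|h| * (e / `|cexp w| * `|h|) = e; last by [].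
  by field; rewrite h0 gt_eqF.
by apply: DeriveDef; [exact: cvgP H | exact: cvg_lim H].
Qed.

End ComplexExponential.

(** * Calculus of holomorphic maps *)

Lemma near_eq_diff (K : numFieldType) (V W : normedModType K) (f g : V -> W) (x : V) :
  (\forall y \near x, f y = g y) -> differentiable f x ->
  differentiable g x /\ 'd g x = 'd f x :> (V -> W).
Proof.
move=> fg df; have fgx := nbhs_singleton fg.
have dc := diff_continuous df.
have E : g \o shift x = cst (g x) + 'd f x +o_ 0 id.
  apply/eqaddoP => e e0; have /eqaddoP := diff_locally df => /(_ e e0) H.
  have fg0 : \forall h \near (0 : V), f (h + x) = g (h + x).
    by move: fg; rewrite (near_shift 0 x) /=; apply: filterS => h /=; rewrite subr0.
  by apply: filterS2 H fg0 => h /= H1 E1; move: H1; rewrite !fctE /= -E1 -fgx.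
have dE := diff_unique dc E.
split; last by rewrite dE.
by apply/diff_locallyP; rewrite dE.
Qed.

Lemma derive_coord (K : numFieldType) n (V : normedModType K) (f : V -> 'rV[K]_n)
    (x v : V) i :
  differentiable f x ->
  differentiable (fun y => f y ord0 i : K^o) x /\
  'D_v (fun y => f y ord0 i : K^o) x = 'D_v f x ord0 i.
Proof.
move=> df; pose L := fun M : 'rV[K]_n => M ord0 i : K^o.
have Ll : linear L by move=> c a b; rewrite /L !mxE.
pose HL := GRing.isLinear.Build _ _ _ _ L Ll.
pose LL : {linear 'rV[K]_n -> K^o} := HB.pack L HL.
have cL : continuous L by move=> M; exact: coord_continuous.
have dL : differentiable L (f x) by exact: differentiable_coord.
have dLE : 'd L (f x) = L :> (_ -> _) by exact: (@diff_lin _ _ _ LL).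
have dc : differentiable (L \o f) x by exact: differentiable_comp.
split; first exact: dc.
by rewrite (deriveE v dc) (deriveE v df) (diff_comp df dL) /= dLE.
Qed.

Lemma linear_row_expand (K : numFieldType) n (W : lmodType K)
    (L : {linear 'rV[K]_n -> W}) (u : 'rV[K]_n) :
  L u = \sum_i u ord0 i *: L (delta_mx ord0 i).
Proof.
by rewrite {1}(row_sum_delta u) linear_sum; apply: eq_bigr => i _; rewrite linearZ.
Qed.

Lemma derive_comp_row (K : numFieldType) n (V : normedModType K) (f : 'rV[K]_n -> K^o)
    (w : V -> 'rV[K]_n) (x v : V) :
  differentiable w x -> differentiable f (w x) ->
  'D_v (f \o w) x = \sum_i 'D_v w x ord0 i * 'D_(delta_mx ord0 i) f (w x).
Proof.
move=> dw df; rewrite deriveE; last exact: differentiable_comp.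
rewrite diff_comp //= linear_row_expand -deriveE //.
by apply: eq_bigr => i _; rewrite -deriveE.
Qed.

Lemma diff_fst (K : numFieldType) (V W : normedModType K) (x : V * W) :
  differentiable (fst : V * W -> V) x /\ 'd (fst : V * W -> V) x = fst :> (V * W -> V).
Proof.
have cf : continuous (fst : V * W -> V) by move=> y; exact: cvg_fst.
pose L : {linear (V * W)%type -> V} := fst.
by split; [exact: (@linear_differentiable _ _ _ L) | exact: (@diff_lin _ _ _ L)].
Qed.

Section CdiffTheory.
Variables (R : realType).
Local Notation C := (R[i]).

Lemma CdiffS (V W : normedModType C) k (D : set V) (f : V -> W) :
  Cdiff k.+1 D f -> Cdiff k D f.
Proof.
elim: k f => [|k IH] f [df Hf]; first by split.
by split=> // v; exact/IH/Hf.
Qed.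

Lemma Cdiff_subset (V W : normedModType C) k (D E : set V) (f : V -> W) :
  D `<=` E -> Cdiff k E f -> Cdiff k D f.
Proof.
move=> DE; elim: k f => [|k IH] f [df Hf]; split=> //; try by move=> x /DE/df.
by move=> v; exact/IH/Hf.
Qed.

(** Differentiability of order [k] is a local property because it asks, point by
    point, for differentiability of the iterated directional derivatives. *)
Lemma Cdiff_local (V W : normedModType C) k (D : set V) (f : V -> W) :
  (forall x, D x -> exists2 E : set V, E x & Cdiff k E f) -> Cdiff k D f.
Proof.
elim: k f => [|k IH] f H; split=> //.
- by move=> x /H[E Ex [df _]]; exact: df.
- by move=> x /H[E Ex [df _]]; exact: df.
- by move=> v; apply: IH => x /H[E Ex [_ Hf]]; exists E => //; exact: Hf.
Qed.

Lemma open_near_eq (K : numFieldType) (V : normedModType K) (T : Type) (D : set V)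
    (f g : V -> T) (x : V) :
  open D -> D x -> (forall y, D y -> f y = g y) -> \forall y \near x, f y = g y.
Proof. by move=> oD Dx fg; apply: filterS fg _; exact: open_nbhs_nbhs. Qed.

Lemma Cdiff_eq (V W : normedModType C) k (D : set V) (f g : V -> W) :
  open D -> (forall x, D x -> f x = g x) -> Cdiff k D f -> Cdiff k D g.
Proof.
move=> oD; elim: k f g => [|k IH] f g fg [df Hf].
  by split=> // x Dx; exact: (near_eq_diff (open_near_eq oD Dx fg) (df x Dx)).1.
split=> [x Dx|v]; first exact: (near_eq_diff (open_near_eq oD Dx fg) (df x Dx)).1.
apply: IH (Hf v) => x Dx; by apply: near_eq_derive; exact: open_near_eq oD Dx fg.
Qed.

Lemma Cdiff_differentiable (V W : normedModType C) k (D : set V) (f : V -> W) x :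
  Cdiff k D f -> D x -> differentiable f x.
Proof. by case: k => [|k] [df _]; exact: df. Qed.

Lemma Cdiff_cst (V W : normedModType C) k (D : set V) (c : W) :
  Cdiff k D (fun=> c).
Proof.
elim: k c => [|k IH] c; split=> //; try by move=> x _; exact: differentiable_cst.
move=> v; rewrite (_ : 'D_v _ = fun=> 0) //.
by apply/funext => x; exact: derive_cst.
Qed.

Lemma CdiffD (V W : normedModType C) k (D : set V) (f g : V -> W) :
  open D -> Cdiff k D f -> Cdiff k D g -> Cdiff k D (f + g).
Proof.
move=> oD; elim: k f g => [|k IH] f g [df Hf] [dg Hg]; split=> //;
  try by move=> x Dx; apply: differentiableD; auto.
move=> v; apply: Cdiff_eq (IH _ _ (Hf v) (Hg v)) => // x Dx.
by rewrite deriveD //; apply: diff_derivable; auto.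
Qed.

Lemma Cdiff_sum (V W : normedModType C) k (D : set V) n (f : 'I_n -> V -> W) :
  open D -> (forall i, Cdiff k D (f i)) -> Cdiff k D (\sum_i f i).
Proof.
move=> oD Hf; elim/big_ind: _ => //; first exact: Cdiff_cst.
by move=> g h; exact: CdiffD.
Qed.

Lemma CdiffM (V : normedModType C) k (D : set V) (f g : V -> C^o) :
  open D -> Cdiff k D f -> Cdiff k D g -> Cdiff k D (f * g).
Proof.
move=> oD; elim: k f g => [|k IH] f g Cf Cg; have [df Hf] := Cf; have [dg Hg] := Cg.
  by split=> [x Dx|]; [apply: differentiableM; [exact: df | exact: dg] | exact: I].
split=> [x Dx|v]; first by apply: differentiableM; [exact: df | exact: dg].
have Cs : Cdiff k D (f * 'D_v g + g * 'D_v f).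
  apply: (CdiffD oD).
    apply: IH; [exact: CdiffS Cf | exact: Hg].
  apply: IH; [exact: CdiffS Cg | exact: Hf].
apply: Cdiff_eq Cs => // x Dx.
by rewrite deriveM //; apply: diff_derivable; [exact: df | exact: dg].
Qed.

Lemma Cdiff_coord n (V : normedModType C) k (D : set V) (f : V -> 'rV[C]_n) i :
  open D -> Cdiff k D f -> Cdiff k D (fun y => f y ord0 i : C^o).
Proof.
move=> oD; elim: k f => [|k IH] f [df Hf]; split=> //;
  try by move=> x Dx; exact: (derive_coord 0 i (df x Dx)).1.
move=> v; apply: (@Cdiff_eq _ _ _ _ (fun y => 'D_v f y ord0 i : C^o)) => //.
  by move=> x Dx; rewrite (derive_coord v i (df x Dx)).2.
exact/IH/Hf.
Qed.

(** By the chain rule the directional derivatives of [f \o w] are sums of products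
    of functions to which the induction hypothesis applies; expanding over the
    standard basis removes the dependence of the direction on the point. *)
Lemma Cdiff_comp n (V : normedModType C) k (D : set V) (E : set 'rV[C]_n)
    (f : 'rV[C]_n -> C^o) (w : V -> 'rV[C]_n) :
  open D -> (forall x, D x -> E (w x)) ->
  Cdiff k D w -> Cdiff k E f -> Cdiff k D (f \o w).
Proof.
move=> oD wE; elim: k f => [|k IH] f Cw Cf; have [dw Hw] := Cw; have [df Hf] := Cf;
  split=> //; try by move=> x Dx; apply: differentiable_comp; auto.
move=> v.
apply: (@Cdiff_eq _ _ _ _
  (\sum_i ((fun x => 'D_v w x ord0 i : C^o) * ('D_(delta_mx ord0 i) f \o w)))) => //.
  move=> x Dx; rewrite fct_sumE derive_comp_row //; auto.
apply: Cdiff_sum => // i; apply: CdiffM => //; first exact/Cdiff_coord/Hw.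
by apply: IH; [exact: CdiffS | exact: Hf].
Qed.

Lemma diff_pairl (V W : normedModType C) (z : V) (y : W) :
  differentiable (fun y : W => (z, y)) y /\
  'd (fun y : W => (z, y)) y = (fun v => (0, v)) :> (W -> V * W).
Proof.
have H : is_diff y (fun y : W => (z, y)) (fun v => (0, v)).
  apply: (@is_diff_pair _ _ _ _ (cst z) 0 id id).
by split; [exact: ex_diff | exact: diff_val].
Qed.

Lemma Cdiff_pairl (V W U : normedModType C) k (D : set W) (E : set (V * W)%type)
    (z : V) (f : (V * W)%type -> U) :
  open D -> (forall y, D y -> E (z, y)) ->
  Cdiff k E f -> Cdiff k D (fun y => f (z, y)).
Proof.
move=> oD DE; elim: k f => [|k IH] f [df Hf].
  split=> // y /DE/df d.
  by apply: differentiable_comp => //; have [] := diff_pairl z y.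
have dc y : D y -> differentiable (f \o (fun y => (z, y))) y.
  by move=> /DE/df d; apply: differentiable_comp => //; have [] := diff_pairl z y.
split=> [//|v].
apply: (Cdiff_eq oD _ (IH _ (Hf (0, v)))) => y Dy; have [d1 d2] := diff_pairl z y.
rewrite (deriveE _ (df _ (DE _ Dy))) (deriveE _ (dc _ Dy)).
by rewrite (diff_comp d1 (df _ (DE _ Dy))) /= d2.
Qed.

End CdiffTheory.

(** * Charts and fibres of the tangent bundle *)

Section ManifoldTheory.
Variables (R : realType).
Local Notation C := (R[i]).

Lemma diff_near_id (V : normedModType C) (f : V -> V) (x : V) :
  (\forall y \near x, f y = y) -> 'd f x = id :> (V -> V).
Proof.
move=> fid; have H : \forall y \near x, id y = f y.
  by apply: filterS fid => y ->.
have did : is_diff x id id by exact: is_diff_id.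
by have [_ ->] := near_eq_diff H (@ex_diff _ _ _ _ _ _ _ did); exact: diff_val.
Qed.

Lemma diff_open_id (V : normedModType C) (D : set V) (f : V -> V) (x : V) :
  open D -> D x -> (forall y, D y -> f y = y) -> 'd f x = id :> (V -> V).
Proof. by move=> oD Dx fid; apply: diff_near_id; exact: open_near_eq oD Dx fid. Qed.

Lemma open_fst (V W : normedModType C) (D : set V) :
  open D -> open [set zt : V * W | D zt.1].
Proof. by move=> oD; apply: open_comp => // zt _; exact: cvg_fst. Qed.

Section Charts.
Variables (V : normedModType C) (X : mfd V).
Hypothesis hX : is_mfd X.

Lemma dom_ctr (x : X) : dom (ctr x) x.
Proof. by case: hX. Qed.

Lemma par_crd (a : idx X) (x : X) : dom a x -> par a (crd a x) = x.
Proof. by case: hX => _ + _ _; exact. Qed.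

Lemma par_dom (a : idx X) (z : V) : (crd a @` dom a) z ->
  dom a (par a z) /\ crd a (par a z) = z.
Proof. by move=> [x ax <-]; rewrite par_crd. Qed.

Lemma open_chart (a : idx X) : open (crd a @` dom a).
Proof. by case: hX => _ _ + _ => /(_ a a); rewrite setIid. Qed.

Lemma transition_differentiable (a b : idx X) (x : X) : dom a x -> dom b x ->
  differentiable (crd b \o par a) (crd a x).
Proof.
move=> ax bx; case: hX => _ _ _ /(_ a b 0%N) H.
by apply: (Cdiff_differentiable H); exists x.
Qed.

Lemma near_crd_par (a : idx X) (x : X) : dom a x ->
  \forall z \near crd a x, (crd a \o par a) z = z.
Proof.
move=> ax; apply: (open_near_eq (open_chart a)); first by exists x.
by move=> z /par_dom[].
Qed.

(** Tangent vectors are written in the preferred chart, so components in that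
    chart are the vector itself. *)
Lemma tcrd_ctr (x : X) (v : V) : tcrd (ctr x) x v = v.
Proof. by rewrite /tcrd (diff_near_id (near_crd_par (dom_ctr x))). Qed.

Lemma tpar_ctr (x : X) (v : V) : tpar (ctr x) x v = v.
Proof. exact: tcrd_ctr. Qed.

Lemma tcrd_tpar (a : idx X) (x : X) (v : V) : dom a x ->
  tcrd a x (tpar a x v) = v.
Proof.
move=> ax; rewrite /tcrd /tpar; set c := ctr x; have cx : dom c x := dom_ctr x.
have E : (crd c \o par a) (crd a x) = crd c x by rewrite /= par_crd.
have d1 : differentiable (crd c \o par a) (crd a x) by exact: transition_differentiable.
have d2 : differentiable (crd a \o par c) ((crd c \o par a) (crd a x)).
  by rewrite E; exact: transition_differentiable.
have := diff_comp d1 d2; rewrite E => /(congr1 (@^~ v)) /= <-.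
rewrite diff_near_id //; case: hX => _ _ /(_ a c) oac _.
apply: (open_near_eq oac); first by exists x.
by move=> _ [y [ay cy] <-]; rewrite /= !par_crd.
Qed.

End Charts.

Section TangentBundle.
Variables (n : nat) (M : mfd 'rV[C]_n).
Hypothesis hM : is_mfd M.
Local Notation V := 'rV[C]_n.
Local Notation X := (tangent_bundle M).

Lemma crd_fibre (p : M) (th : V) :
  @crd _ _ X (ctr p) (p, th) = (crd (ctr p) p, th).
Proof. by rewrite /= tcrd_ctr. Qed.

Lemma par_fibre (p : M) (th : V) :
  @par _ _ X (ctr p) (crd (ctr p) p, th) = (p, th).
Proof. by rewrite /= par_crd ?tpar_ctr //; exact: dom_ctr. Qed.

Lemma tcrd_fibre (p : M) (th : V) (w : (V * V)%type) :
  @tcrd _ _ X (ctr p) (p, th) w = w.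
Proof.
rewrite /tcrd -[@ctr _ _ X (p, th)]/(ctr p) crd_fibre.
rewrite (diff_open_id (open_fst (W := V) (open_chart hM (ctr p)))) //=.
  by exists p => //; exact: dom_ctr.
by move=> [z t] /= /(par_dom hM) [ax E]; rewrite E tcrd_tpar.
Qed.

(** Tangent vectors to the fibre are the vertical vectors [(0, v)]. *)
Lemma mdiff_fibre_incl (p : M) (th v : V) :
  @mdiff _ _ _ (flat V) X (fibre_incl p) th v = (0, v).
Proof.
rewrite /mdiff; set f := (f in 'd f _).
have -> : f = (fun y => (crd (ctr p) p, y)).
  by apply/funext => y; rewrite -crd_fibre.
by rewrite /= (diff_pairl _ _).2.
Qed.

Lemma comp_fibre_incl (W : normedModType C) (Y : mfd W) (c : idx Y) (f : X -> Y) (p : M) :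
  crd c \o (f \o fibre_incl p) =
  (fun y => (crd c \o f \o @par _ _ X (ctr p)) (crd (ctr p) p, y)).
Proof.
apply/funext => y; apply: (congr1 (fun x : X => crd c (f x))).
by rewrite par_fibre.
Qed.

Lemma mholo_chart_differentiable (W : normedModType C) (Y : mfd W) (c : idx Y)
    (O : set X) (f : X -> Y) (p : M) (th : V) :
  mholo O f -> O (p, th) -> dom c (f (p, th)) ->
  differentiable (crd c \o f \o @par _ _ X (ctr p)) (@crd _ _ X (ctr p) (p, th)).
Proof.
move=> hf Op cf; have [_ H] := hf (ctr p) c.
apply: (Cdiff_differentiable (H 0%N)); exists (p, th) => //.
by split=> //; exact: dom_ctr.
Qed.

(** The chain rule for the restriction of [f] to the fibre over [p], in the chart
    of the tangent bundle in which the inclusion of the fibre is affine. *)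
Lemma mdiff_comp_fibre (W : normedModType C) (Y : mfd W) (O : set X) (f : X -> Y)
    (p : M) (th v : V) :
  (forall y : Y, dom (ctr y) y) -> mholo O f -> O (p, th) ->
  @mdiff _ _ _ (flat V) Y (f \o fibre_incl p) th v = mdiff f (p, th) (0, v).
Proof.
move=> hY hf Op; rewrite /mdiff.
have d := mholo_chart_differentiable hf Op (hY (f (p, th))).
rewrite -[@ctr _ _ X (p, th)]/(ctr p); rewrite crd_fibre in d *.
set c := ctr (f (p, th)) in d *.
have E := comp_fibre_incl c f p.
rewrite -[(crd c \o _) \o _]/(crd c \o (f \o fibre_incl p)).
rewrite E -[@crd _ _ (flat V) _ th]/th.
set g := crd c \o f \o _; have [d1 d2] := diff_pairl (crd (ctr p) p) th.
rewrite -[fun y => g _]/(g \o (fun y => (crd (ctr p) p, y))).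
by rewrite (diff_comp d1 d) /= d2.
Qed.

(** Holomorphy is tested on the chart of the tangent bundle around the fibre,
    where the inclusion is the affine map theta to (z(p), theta). *)
Lemma mholo_comp_fibre (W : normedModType C) (Y : mfd W) (f : X -> Y) (p : M) :
  mholo setT f -> @mholo _ _ _ (flat V) Y setT (f \o fibre_incl p).
Proof.
move=> hf a b /=; rewrite !setTI image_id.
have [] := hf (ctr p) b; rewrite setTI.
set D := @crd _ _ X (ctr p) @` _ => oD HD.
have DE (y : V) : ((f \o fibre_incl p) @^-1` dom b) y <-> D (crd (ctr p) p, y).
  split=> [fy|[[x t] [/= ax bx]]].
    by exists (p, y); [split=> //; exact: dom_ctr | exact: crd_fibre].
  move=> [Ex Et].
  have xp : x = p by rewrite -(par_crd hM ax) Ex par_crd //; exact: dom_ctr.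
  by move: Et bx; rewrite xp tcrd_ctr // => ->.
have oP : open ((f \o fibre_incl p) @^-1` dom b).
  have -> : (f \o fibre_incl p) @^-1` dom b = (fun y => (crd (ctr p) p, y)) @^-1` D.
    by apply/seteqP; split=> y /DE.
  apply: open_comp => // y _.
  by apply: differentiable_continuous; have [] := diff_pairl (crd (ctr p) p) y.
split=> // k; have H := comp_fibre_incl b f p.
rewrite -[(_ \o (f \o _)) \o _]/(crd b \o (f \o fibre_incl p)) H.
by apply: Cdiff_pairl (HD k) => // y /DE.
Qed.

End TangentBundle.
End ManifoldTheory.

(** * Pullback of symplectic potentials *)

Section Pullback.
Variables (R : realType) (n : nat).
Local Notation C := (R[i]).
Variables (V : normedModType C) (Z : mfd 'rV[C]_n) (phi : flat V -> Z).
Hypotheses (hZ : is_mfd Z) (hphi : @mholo _ _ _ (flat V) Z setT phi).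
Variables (U : set Z) (Th : form1 Z).
Hypotheses (oU : mopen U) (hTh : holo_form1 U Th).

Let w (b : idx Z) : V -> 'rV[C]_n := crd b \o phi.
Let N (b : idx Z) : set V := [set y | dom b (phi y) /\ U (phi y)].
Let E (b : idx Z) : set 'rV[C]_n := crd b @` (dom b `&` U).

Let open_phi_dom b : open (phi @^-1` dom b : set V).
Proof. by have [+ _] := hphi tt b; rewrite /= !setTI image_id. Qed.

Let holo_w b k : Cdiff k (phi @^-1` dom b) (w b).
Proof. by have [_ /(_ k)] := hphi tt b; rewrite /= !setTI image_id. Qed.

Let N_E b y : N b y -> E b (w b y).
Proof. by move=> hy; exists (phi y). Qed.

Let N_open b : open (N b).
Proof.
rewrite openE => y [by_ uy].
have dw : differentiable (w b) y by apply: (Cdiff_differentiable (holo_w b 0)).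
have nE : \forall x \near y, E b (w b x).
  apply: (differentiable_continuous dw); apply: open_nbhs_nbhs; split; first exact: oU.
  exact: N_E.
have nD : \forall x \near y, dom b (phi x).
  by apply: open_nbhs_nbhs; split; [exact: open_phi_dom | exact: by_].
apply: filterS2 nE nD => x [z [bz uz] Ez] bx; split=> //.
by rewrite -(par_crd hZ bx) -[crd b _]Ez par_crd.
Qed.

Let N_w b k : Cdiff k (N b) (w b).
Proof. by apply: Cdiff_subset (holo_w b k) => y []. Qed.

Let form1_in_expand b y u : E b y -> form1_in Th b y u =
  \sum_i u ord0 i * form1_in Th b y (delta_mx ord0 i).
Proof.
move=> [z [bz uz] <-]; have [lin _] := hTh.
pose L := fun u => form1_in Th b (crd b z) u.
have Ll : linear (L : _ -> C^o).
  by move=> c a d; rewrite /L /form1_in /tpar linearP par_crd // lin.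
pose HL := GRing.isLinear.Build _ _ _ _ (L : _ -> C^o) Ll.
pose LL : {linear 'rV[C]_n -> C^o} := HB.pack (L : _ -> C^o) HL.
exact: (linear_row_expand LL u).
Qed.

(** The differential of [phi], taken towards the preferred chart of [phi y], is
    that of [w] followed by the transition from [b]; the transition is absorbed
    in the coordinate expression of the form. *)
Let pull1E b y v : N b y ->
  pull1 phi Th y v = form1_in Th b (w b y) ('d (w b) y v).
Proof.
move=> [by_ uy]; rewrite /pull1 /form1_in /w /= par_crd //; congr (Th _ _).
rewrite /mdiff /tpar; set c := ctr (phi y).
have cy : dom c (phi y) by exact: dom_ctr.
have dw : differentiable (w b) y by apply: (Cdiff_differentiable (holo_w b 0)).
have dt := transition_differentiable hZ by_ cy.
have H : \forall x \near y, ((crd c \o par b) \o w b) x = (crd c \o phi) x.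
  apply: (open_near_eq (open_phi_dom b)) => // x bx.
  by rewrite /= /w /= par_crd.
have [_ E1] := near_eq_diff H (differentiable_comp dw dt).
rewrite -[(_ \o phi) \o _]/(crd c \o phi) -[@crd _ _ (flat V) _ y]/y.
have D := diff_comp dw dt.
exact: etrans (congr1 (@^~ v) E1) (congr1 (@^~ v) D).
Qed.

Let wi b i : V -> C^o := fun y => w b y ord0 i.
Let G b i : 'rV[C]_n -> C^o := fun y => form1_in Th b y (delta_mx ord0 i).

(** The coordinate formula for a pullback: [sum_i (G_i o w) dw_i], with [G_i]
    the coefficients of the form. *)
Let pull1_sum b y v : N b y ->
  pull1 phi Th y v = \sum_i 'D_v (wi b i) y * G b i (w b y).
Proof.
move=> Ny; rewrite (pull1E _ Ny) form1_in_expand; last exact: N_E.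
have dw := Cdiff_differentiable (N_w b 0) Ny.
apply: eq_bigr => i _; rewrite -(deriveE _ dw).
by rewrite -(derive_coord v i dw).2.
Qed.

Let Cdiff_wi b i k : Cdiff k (N b) (wi b i).
Proof. by apply: Cdiff_coord; [exact: N_open | exact: N_w]. Qed.

Let Cdiff_Dwi b i v k : Cdiff k (N b) ('D_v (wi b i)).
Proof. by have [_ H] := Cdiff_wi b i k.+1; exact: H. Qed.

Let Cdiff_Gw b i k : Cdiff k (N b) (G b i \o w b).
Proof.
apply: (Cdiff_comp (E := E b)); [exact: N_open | exact: N_E | exact: N_w |].
by have [_ H] := hTh; exact: H.
Qed.

Let flat_form1_in (al : form1 (flat V)) a y v : form1_in al a y v = al y v.
Proof.
rewrite /form1_in /tpar; congr (al _ _).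
by rewrite diff_near_id //; exact: nearW.
Qed.

Let holo_pull1 : holo_form1 (phi @^-1` U : set (flat V)) (pull1 phi Th).
Proof.
split=> [y uy c u v|a v k].
  by have [lin _] := hTh; rewrite /pull1 /mdiff linearP lin.
rewrite /= setTI image_id; apply: Cdiff_local => y uy.
set b := ctr (phi y).
exists (N b); first by split=> //; exact: dom_ctr.
have S : Cdiff k (N b) (\sum_i ('D_v (wi b i) * (G b i \o w b))).
  apply: Cdiff_sum => [|i]; first exact: N_open.
  apply: CdiffM; [exact: N_open | exact: Cdiff_Dwi | exact: Cdiff_Gw].
apply: Cdiff_eq S; first exact: N_open.
by move=> x Nx; rewrite flat_form1_in (pull1_sum _ Nx) fct_sumE.
Qed.

Let open_pull : open (phi @^-1` U : set V).
Proof.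
rewrite openE => y uy; set b := ctr (phi y).
have : nbhs y (N b).
  by apply: open_nbhs_nbhs; split; [exact: N_open | split=> //; exact: dom_ctr].
by apply: filterS => x [].
Qed.

Let derive_pull1 b y u v : N b y -> 'D_u (fun x => pull1 phi Th x v) y =
  \sum_i ('D_v (wi b i) y * 'D_u (G b i \o w b) y
          + G b i (w b y) * 'D_u ('D_v (wi b i)) y).
Proof.
move=> Ny.
have dG i : derivable (G b i \o w b) y u.
  by apply: diff_derivable; exact: Cdiff_differentiable (Cdiff_Gw b i 0) Ny.
have dD i : derivable ('D_v (wi b i)) y u.
  by apply: diff_derivable; exact: Cdiff_differentiable (Cdiff_Dwi b i v 0) Ny.
have -> : 'D_u (fun x => pull1 phi Th x v) y =
  'D_u (\sum_i ('D_v (wi b i) * (G b i \o w b))) y.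
  apply: near_eq_derive; apply: (open_near_eq (N_open b)) => // x Nx.
  by rewrite (pull1_sum _ Nx) fct_sumE.
rewrite derive_sum => [|i]; last exact: derivableM.
by apply: eq_bigr => i _; rewrite deriveM.
Qed.

Let derive_form1_in b y u v : E b y ->
  'D_u (fun x => form1_in Th b x v) y = \sum_i v ord0 i * 'D_u (G b i) y.
Proof.
move=> Ey.
have dG i : derivable (G b i) y u.
  have [_ H] := hTh; apply: diff_derivable.
  exact: (Cdiff_differentiable (H b (delta_mx ord0 i) 0%N)).
have -> : 'D_u (fun x => form1_in Th b x v) y =
  'D_u (\sum_i (v ord0 i *: G b i)) y.
  apply: near_eq_derive.
  apply: (@open_near_eq C 'rV[C]_n _ (E b)) => [||x Ex]; [exact: oU|by []|].
  by rewrite (form1_in_expand _ Ex) fct_sumE.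
rewrite derive_sum => [|i]; last exact: derivableZ.
by apply: eq_bigr => i _; rewrite deriveZ.
Qed.

(** Exterior differentiation commutes with pullback: the terms with second
    derivatives of phi cancel by symmetry. *)
Let extd1_pull1 y u v : U (phi y) ->
  extd1 (pull1 phi Th) y u v = pull2 phi (extd1 Th) y u v.
Proof.
move=> uy; rewrite /pull2 /extd1; set b := ctr (phi y).
have Ny : N b y by split=> //; exact: dom_ctr.
have dw := Cdiff_differentiable (N_w b 0) Ny.
have mE x : mdiff phi y x = 'D_x (w b) y by rewrite deriveE.
have fE x : (fun z => form1_in (pull1 phi Th) (ctr y) z x) =
    (fun z => pull1 phi Th z x).
  by apply/funext => z; rewrite flat_form1_in.
rewrite !fE -[@crd _ _ (flat V) _ y]/y !(derive_pull1 _ _ Ny).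
rewrite !derive_form1_in; [|exact: N_E|exact: N_E].
have DG x i : 'D_x (G b i \o w b) y = 'D_(mdiff phi y x) (G b i) (crd b (phi y)).
  have [_ H] := hTh.
  have dG := Cdiff_differentiable (H b (delta_mx ord0 i) 0%N) (N_E Ny).
  rewrite -/(G b i) in dG.
  rewrite deriveE; last exact: differentiable_comp.
  by rewrite (diff_comp dw dG) /= mE (deriveE _ dw) (deriveE _ dG).
have sym i : 'D_u ('D_v (wi b i)) y = 'D_v ('D_u (wi b i)) y.
  apply: derive_comm.
  - apply: filterS (open_nbhs_nbhs (conj (N_open b) Ny)) => x Nx.
    exact: Cdiff_differentiable (Cdiff_wi b i 0) Nx.
  - exact: Cdiff_differentiable (Cdiff_Dwi b i v 0) Ny.
  - exact: Cdiff_differentiable (Cdiff_Dwi b i u 0) Ny.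
have Dw x i : 'D_x (wi b i) y = mdiff phi y x ord0 i.
  by rewrite mE; exact: (derive_coord x i dw).2.
(* The second derivatives g1 and g2 cancel, their coefficients being equal. *)
have alg (p p' a a' q q' d d' r g1 g2 : C) :
    p = p' -> a = a' -> q = q' -> d = d' -> g1 = g2 ->
    (p * a + r * g1) - (q * d + r * g2) = p' * a' - q' * d'.
  by move=> -> -> -> -> ->; rewrite opprD addrACA subrr addr0.
rewrite -!sumrB; apply: eq_bigr => i _.
exact: alg (Dw v i) (DG u i) (Dw u i) (DG v i) (sym i).
Qed.

Lemma symplectic_potential_pull (Om : form2 Z) :
  symplectic_potential Om U Th ->
  symplectic_potential (pull2 phi Om) (phi @^-1` U : set (flat V)) (pull1 phi Th).
Proof.
move=> [_ _ dTh]; split.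
- by move=> a; rewrite /= setTI image_id; exact: open_pull.
- exact: holo_pull1.
- by move=> y uy u v; rewrite extd1_pull1 // /pull2 dTh.
Qed.

End Pullback.

(** * The twistor maps on a fibre *)

Section FibreForms.
Variables (R : realType) (n : nat).
Local Notation C := (R[i]).
Local Notation V := 'rV[C]_n.

(** A translation-invariant two-form has constant coefficients, hence is closed
    and holomorphic. *)
Lemma constant_symplectic_form (W : normedModType C) (B : W -> W -> C^o) :
  (forall c u v w, B (c *: u + v) w = c * B u w + B v w) ->
  (forall u v, B u v = - B v u) ->
  (forall u, (forall v, B u v = 0) -> u = 0) ->
  symplectic_form (fun _ : flat W => B).
Proof.
move=> lB aB nB.
have E (a : idx (flat W)) u v :
    (fun z => form2_in (fun _ : flat W => B) a z u v) = (fun=> B u v).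
  apply/funext => z; rewrite /form2_in /tpar.
  by rewrite diff_near_id //; exact: nearW.
split=> //.
- by split=> // a u v k; rewrite E; exact: Cdiff_cst.
- by move=> x u v w; rewrite /extd2 !E !derive_cst !addr0.
Qed.

Variables (M : mfd V) (hM : is_mfd M).
Local Notation X := (tangent_bundle M).

(** In charts the bundle projection is the first projection [(z, theta)] to [z]. *)
Lemma mdiff_proj_vertical (p : M) (th v : V) :
  mdiff (bundle_proj M) ((p, th) : X) (0, v) = 0.
Proof.
rewrite /mdiff -[@ctr _ _ X (p, th)]/(ctr p) -[bundle_proj M (p, th)]/p.
have oD := open_fst (W := V) (open_chart hM (ctr p)).
set f := (f in 'd f _).
have fE : forall zt : V * V, (crd (ctr p) @` dom (ctr p)) zt.1 -> zt.1 = f zt.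
  by move=> zt /(par_dom hM) [_ E]; rewrite /f /= E.
have Dp : (crd (ctr p) @` dom (ctr p)) (@crd _ _ X (ctr p) (p, th)).1.
  by exists p => //; exact: dom_ctr.
have [dfst dfstE] := diff_fst (@crd _ _ X (ctr p) (p, th)).
have [_ E] := near_eq_diff (open_near_eq oD Dp fE) dfst.
apply: etrans (congr1 (@^~ (0, v)) E) _.
by rewrite dfstE.
Qed.

Variable J : joyce_structure M.

Lemma dz_vertical (p : M) (th u : V) k : dz (ctr p) k ((p, th) : X) (0, u) = 0.
Proof. by rewrite /dz tcrd_fibre // mxE. Qed.

Lemma dth_vertical (p : M) (th u : V) k :
  dth (ctr p) k ((p, th) : X) (0, u) = u ord0 k.
Proof. by rewrite /dth tcrd_fibre. Qed.

Lemma Omega_plus_vertical (p : M) (th u v : V) :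
  Omega_plus J (p, th) (0, u) (0, v) = 0.
Proof.
rewrite /Omega_plus -[@ctr _ _ X (p, th)]/(ctr p) big1 ?mulr0 // => k _.
by rewrite big1 // => l _; rewrite /wedge !dz_vertical !mul0r subrr mulr0.
Qed.

Lemma Omega_I_vertical (p : M) (th u v : V) :
  Omega_I J (p, th) (0, u) (0, v) = 0.
Proof.
rewrite /Omega_I -[@ctr _ _ X (p, th)]/(ctr p) big1 ?oppr0 ?mulr0 // => k _.
by rewrite big1 // => l _; rewrite /wedge !dz_vertical !mul0r subrr mulr0.
Qed.

Lemma Theta_I_flip_vertical (p : M) (th v : V) :
  Theta_I_flip J (p, th) (0, v) = 0.
Proof.
rewrite /Theta_I_flip -[@ctr _ _ X (p, th)]/(ctr p) big1 ?oppr0 ?mulr0 // => k _.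
by rewrite big1 // => l _; rewrite dz_vertical mulr0.
Qed.

(** Only the first term of [Omega_minus] has no factor [dz], and [dz] vanishes on
    vertical vectors; its coefficients are those of [omega]. *)
Lemma Omega_minus_vertical (p : M) (th u v : V) :
  Omega_minus J (p, th) (0, u) (0, v) = omega J p u v.
Proof.
rewrite /Omega_minus -[@ctr _ _ X (p, th)]/(ctr p).
rewrite [X in _ + X + _]big1 => [|k _]; last first.
  by rewrite big1 // => l _; rewrite /wedge !dz_vertical !mulr0 subrr mulr0.
rewrite [X in _ + _ + X]big1 => [|k _]; last first.
  by rewrite big1 // => l _; rewrite /wedge !dz_vertical !mul0r subrr mulr0.
rewrite !addr0; have [_ ->] := J_om J (ctr p); last exact: dom_ctr.
congr (_ * _); apply: eq_bigr => k _; apply: eq_bigr => l _.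
by rewrite /wedge !dth_vertical /dz0 !tcrd_ctr.
Qed.

Lemma twistor_vertical t (Z : twistor_fibre J t) (p : M) (th u v : V) :
  pull2 (qmap Z) (Omega_Z Z) ((p, th) : X) (0, u) (0, v) = omega J p u v.
Proof.
by rewrite Z_pullback Omega_plus_vertical Omega_I_vertical Omega_minus_vertical
  !mulr0 !add0r.
Qed.

Section TwistorMap.
Variables (t : C) (Z : twistor_fibre J t) (p : M).

Lemma twistor_is_mfd : is_mfd Z.
Proof. by case: (Z_leaf_space Z) => -[]. Qed.

Lemma twistor_mholo : mholo setT (qmap Z).
Proof. by case: (Z_leaf_space Z) => -[]. Qed.

Lemma mdiff_twistor_fibre (th v : V) :
  @mdiff _ _ _ (flat V) Z (qmap Z \o fibre_incl p) th v = mdiff (qmap Z) (p, th) (0, v).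
Proof.
apply: (@mdiff_comp_fibre _ _ _ hM _ Z setT) => //; last exact: twistor_mholo.
by move=> y; exact: (dom_ctr twistor_is_mfd).
Qed.

(** Each twistor map restricts to a symplectic map of the fibre into the
    twistor fibre, with the same linear form for every epsilon. *)
Lemma pull2_twistor_fibre (th u v : V) :
  @pull2 _ _ _ (flat V) Z (qmap Z \o fibre_incl p) (Omega_Z Z) th u v = omega J p u v.
Proof. by rewrite /pull2 !mdiff_twistor_fibre -(twistor_vertical Z p th). Qed.

Lemma pull1_twistor_fibre (Th : form1 Z) (th v : V) :
  @pull1 _ _ _ (flat V) X (fibre_incl p) (pull1 (qmap Z) Th) th v =
  @pull1 _ _ _ (flat V) Z (qmap Z \o fibre_incl p) Th th v.
Proof. by rewrite /pull1 mdiff_twistor_fibre mdiff_fibre_incl. Qed.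

Lemma pull2_fibre_comp (th u v : V) :
  @pull2 _ _ _ (flat V) X (fibre_incl p) (pull2 (qmap Z) (Omega_Z Z)) th u v =
  omega J p u v.
Proof. by rewrite /pull2 !mdiff_fibre_incl // -(twistor_vertical Z p th). Qed.

End TwistorMap.

Lemma omega_fibre_symplectic (p : M) : symplectic_form (fun _ : flat V => omega J p).
Proof.
have [[lB aB _] _ nB] := J_symplectic J.
apply: constant_symplectic_form; [exact: lB | exact: aB | exact: nB].
Qed.

End FibreForms.

(** Differentiate [cexp \o K = f]. *)
Lemma dlog_log_branch (R : realType) (W : normedModType R[i]) (D : set (flat W))
    (K f : flat W -> R[i]^o) :
  mopen D -> log_branch D K f -> forall x, D x -> forall v, dfun K x v = dlog f x v.
Proof.
move=> oD [hK eK] x Dx v.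
have dK : differentiable (K : W -> R[i]^o) x.
  have [_ H] := hK tt tt.
  by apply: (Cdiff_differentiable (H 0%N)); exists x.
have oD' : open (D : set W) by have := oD tt; rewrite /= setTI image_id.
have H : \forall y \near (x : W), ((@cexp R : R[i]^o -> R[i]^o) \o K) y = f y.
  exact: (open_near_eq oD').
have dc := is_derive_cexp (K x).
have dexp : differentiable (@cexp R : R[i]^o -> R[i]^o) (K x).
  by apply/derivable1_diffP; case: dc.
have [_ E] := near_eq_diff H (differentiable_comp dK dexp).
have dexpE z : 'd (@cexp R : R[i]^o -> R[i]^o) (K x) z = z * cexp (K x).
  case: dc => _ <-; rewrite (deriveE _ dexp) -[z in LHS]mulr1.
  exact: linearZ.
rewrite /dlog.
have -> : dfun f x v = dfun K x v * cexp (K x).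
  rewrite /dfun /mdiff; apply: etrans (congr1 (@^~ v) E) _.
  apply: etrans (congr1 (@^~ v) (diff_comp dK dexp)) _.
  exact: dexpE.
by rewrite -(eK x Dx); exact: esym (mulfK (cexp_neq0 (K x)) (dfun K x v)).
Qed.

Theorem mainTheorem2 (R : realType) (n : nat) (M : mfd 'rV[R[i]]_n)
    (J : joyce_structure M)
    (Z1 : twistor_fibre J 1) (Zinf : twistor_fibre J 0)
    (Einf : vfield Zinf)
    (hEinf : forall x, mdiff (qmap Zinf) x (euler_total x)
                       = Einf (qmap Zinf x))
    (U0 : set M) (Theta0 : form1 M)
    (hTheta0 : symplectic_potential (omega J) U0 Theta0)
    (hE0 : forall x, U0 x -> forall v,
       lie1 (@euler_base R n M) Theta0 x v = 2 * Theta0 x v)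
    (U1 : set Z1) (Theta1 : form1 Z1)
    (hTheta1 : symplectic_potential (Omega_Z Z1) U1 Theta1)
    (Uinf : set Zinf) (Thetainf : form1 Zinf)
    (hThetainf : symplectic_potential (Omega_Z Zinf) Uinf Thetainf)
    (hEinf0 : forall x, Uinf x -> forall v, lie1 Einf Thetainf x v = 0)
    (O : set (tangent_bundle M)) (tau : tangent_bundle M -> R[i]^o)
    (hO : mopen O)
    (hO0 : O `<=` bundle_proj M @^-1` U0)
    (hO1 : O `<=` qmap Z1 @^-1` U1)
    (hOinf : O `<=` qmap Zinf @^-1` Uinf)
    (htau : holo_fun O tau)
    (htau0 : forall x, O x -> tau x != 0)
    (hdlog : forall x, O x -> forall v,
       dlog tau x v
       = pull1 (bundle_proj M) Theta0 x v + 2 * 'i * Theta_I_flip J x v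
         + pull1 (qmap Zinf) Thetainf x v - pull1 (qmap Z1) Theta1 x v)
    (p : M) :
  let j := fibre_incl p in
  let OmegaF := pull2 j (pull2 (qmap Zinf) (Omega_Z Zinf)) in
  let ThetaF := pull1 j (pull1 (qmap Zinf) Thetainf) in
  let UF := j @^-1` (qmap Zinf @^-1` Uinf) in
  [/\ forall a : idx M, dom a p -> forall th u v,
        OmegaF th u v
        = 2^-1 * \sum_k \sum_l
            om J a k l * wedge (dthF p a k) (dthF p a l) th u v,
      (forall th u v, OmegaF th u v = omega J p u v) /\ symplectic_form OmegaF,
      symplectic_potential OmegaF UF ThetaF,
      forall th, (j @^-1` O) th -> forall v,
        dlog (tau \o j) th v
        = pull1 j (pull1 (qmap Zinf) Thetainf) th v
          - pull1 j (pull1 (qmap Z1) Theta1) th v &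
      forall (D : set (flat 'rV[R[i]]_n)) (K : flat 'rV[R[i]]_n -> R[i]^o),
        mopen D -> D `<=` j @^-1` O -> log_branch D K (tau \o j) ->
        generating_function OmegaF (Omega_Z Z1) (qmap Z1 \o j)
          UF ThetaF U1 Theta1 D K].
Proof.
move=> j OmegaF ThetaF UF.
have hM : is_mfd M by case: (J_period J).
have hOF th u v : OmegaF th u v = omega J p u v by exact: pull2_fibre_comp.
have phiE (t : R[i]) (Z : twistor_fibre J t) : OmegaF = pull2 (qmap Z \o j) (Omega_Z Z).
  apply/funext => th; apply/funext => u; apply/funext => v.
  by rewrite hOF; apply: esym; exact: pull2_twistor_fibre.
have sF : symplectic_form OmegaF.
  rewrite (_ : OmegaF = fun=> omega J p); first exact: omega_fibre_symplectic.
  by apply/funext => th; apply/funext => u; apply/funext => v.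
have pF : symplectic_potential OmegaF UF ThetaF.
  have -> : ThetaF = pull1 (qmap Zinf \o j) Thetainf.
    apply/funext => th; apply/funext => v; exact: pull1_twistor_fibre.
  rewrite (phiE _ Zinf); have [oU hTh _] := hThetainf.
  apply: symplectic_potential_pull => //; first exact: twistor_is_mfd.
  by apply: mholo_comp_fibre => //; exact: twistor_mholo.
have dF th : (j @^-1` O) th -> forall v,
    dlog (tau \o j) th v = ThetaF th v - pull1 j (pull1 (qmap Z1) Theta1) th v.
  move=> Oth v.
  have -> : dlog (tau \o j) th v = dlog tau (p, th) (0, v).
    congr (_ / _).
    exact: (@mdiff_comp_fibre _ _ _ hM _ (flat R[i]^o) O tau p th v (fun=> I) htau Oth).
  (* Linearity applied to -1 *: 0 + 0. *)
  have lin0 : Theta0 p 0 = 0.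
    have [_ [lin _] _] := hTheta0.
    have := lin p (hO0 _ Oth) (-1) 0 0.
    by rewrite scaler0 addr0 mulN1r addNr.
  rewrite hdlog // Theta_I_flip_vertical // mulr0 addr0.
  rewrite [pull1 (bundle_proj M) _ _ _]/pull1 mdiff_proj_vertical // lin0 add0r.
  by rewrite /ThetaF /pull1 !mdiff_fibre_incl.
split=> //.
- move=> a ap th u v; rewrite hOF.
  by have [_ ->] := J_om J a.
- move=> D K oD DO hK; split=> //.
  + by split=> //; exact: Z_symplectic.
  + split; first by apply: mholo_comp_fibre => //; exact: twistor_mholo.
    by move=> th u v; rewrite (phiE _ Z1).
  + split=> //; last by case: hK.
      by move=> th /DO/hOinf.
    by move=> th /DO/hO1.
  + move=> th Dth v; rewrite (dlog_log_branch oD hK Dth) dF; last exact: DO.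
    by congr (_ - _); exact: pull1_twistor_fibre.
Qed.
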